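(* Let $\mathcal{H}$ be a real Hilbert space and let $f:\mathcal{H}\to\mathbb{R}$ be a convex function of class $\mathcal{C}^1$ such that $S:=\operatorname{argmin}_{\mathcal{H}} f\neq\emptyset$ and $\nabla f$ is Lipschitz continuous on every bounded subset of $\mathcal{H}$. Let $s_0>0$, assume that $\alpha>1$, and let $x:[s_0,+\infty[\to\mathcal{H}$ be a solution trajectory of $$\ddot x(s)+\frac{\alpha}{s}\dot x(s)+\nabla f\left(x(s)+\frac{s}{\alpha-1}\dot x(s)\right)=0.$$ Then the following statements are true: (i) $\int_{s_0}^{+\infty}s^3\left\|\nabla f\left(x(s)+\frac{s}{\alpha-1}\dot x(s)\right)\right\|^2ds<+\infty$; (ii) $\left\|\nabla f\left(x(s)+\frac{s}{\alpha-1}\dot x(s)\right)\right\|=o\left(\frac1{s^2}\right)$ as $s\to+\infty$; (iii) $\|\dot x(s)\|=o\left(\frac1s\right)$ as $s\to+\infty$; (iv) $x(s)$ converges weakly as $s\to+\infty$, and its limit belongs to $S$. If $\alpha>3$, then (v) $f(x(s))-\inf_{\mathcal{H}}f=o\left(\frac1{s^2}\right)$ as $s\to+\infty$.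
   Context: A solution trajectory is a twice continuously differentiable function satisfying the equation for every $s\ge s_0$. *)

(* Defs.v *)
From HB Require Import structures.
From mathcomp Require Import all_boot all_order all_algebra.
From mathcomp Require Import all_classical all_reals all_analysis.

Set Implicit Arguments.
Unset Strict Implicit.
Unset Printing Implicit Defensive.

Import Order.TTheory GRing.Theory Num.Theory.
Import numFieldNormedType.Exports.

Local Open Scope classical_set_scope.
Local Open Scope ring_scope.

(* Lets the Landau notation [=o_+oo] be used for functions of a real variable. *)
Canonical pinfty_nbhs_filter_on (R : numFieldType) :=
  @FilterType R (pinfty_nbhs R) _.

(* A real Hilbert space is a complete normed module [H] with a dot product
   [dot] (bilinear, symmetric, positive definite) inducing its norm. *)
Definition norm_from_dot (R : realType) (H : normedModType R)
    (dot : {dot H for (idfun : R -> R)}) : Prop :=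
  forall u : H, `|u| ^+ 2 = dot u u.

(* Frechet-C^1: the differential is continuous for the operator norm of the
   dual. *)
Definition class_C1 (R : realType) (H : normedModType R) (f : H -> R) : Prop :=
  (forall y : H, differentiable f y) /\
  (forall (y : H) (e : R), 0 < e ->
     \forall z \near y, forall v : H, `|'d f z v - 'd f y v| <= e * `|v|).

(* The Riesz representative of the differential; unspecified at a point where
   no such vector exists. *)
Definition gradient (R : realType) (H : normedModType R)
    (dot : {dot H for (idfun : R -> R)}) (f : H -> R) (y : H) : H :=
  get [set g : H | forall v : H, 'd f y v = dot g v].

Definition argmin (R : realType) (H : Type) (f : H -> R) : set H :=
  [set y | forall z, f y <= f z].

(* Derivatives relative to a set [D] of a function that is only meaningful on
   [D]: the usual derivative in the interior of an interval [D], a one-sided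
   one at an endpoint belonging to [D]. *)
Definition derivable_on (R : realType) (H : normedModType R)
    (D : set R) (x : R -> H) (s : R) : Prop :=
  cvg ((t - s)^-1 *: (x t - x s) @[t --> within D s^']).

Definition derive_on (R : realType) (H : normedModType R)
    (D : set R) (x : R -> H) (s : R) : H :=
  lim ((t - s)^-1 *: (x t - x s) @[t --> within D s^']).

Definition class_C2_on (R : realType) (H : normedModType R)
    (D : set R) (x : R -> H) : Prop :=
  [/\ {in D, forall s, derivable_on D x s},
      {in D, forall s, derivable_on D (derive_on D x) s} &
      {within D, continuous (derive_on D (derive_on D x))}].

Definition velocity (R : realType) (H : normedModType R)
    (s0 : R) (x : R -> H) : R -> H :=
  derive_on `[s0, +oo[ x.

Definition acceleration (R : realType) (H : normedModType R)
    (s0 : R) (x : R -> H) : R -> H :=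
  derive_on `[s0, +oo[ (velocity s0 x).

(* Only the restriction of [x] to [s0, +oo[ is constrained. *)
Definition solution_trajectory (R : realType) (H : normedModType R)
    (dot : {dot H for (idfun : R -> R)}) (f : H -> R) (alpha s0 : R)
    (x : R -> H) : Prop :=
  class_C2_on `[s0, +oo[ x /\
  forall s : R, s0 <= s ->
    acceleration s0 x s + (alpha / s) *: velocity s0 x s
    + gradient dot f (x s + (s / (alpha - 1)) *: velocity s0 x s) = 0.

(* Convergence along a filter in the weak topology, tested against all
   continuous linear functionals. *)
Definition weakly_cvg_to (R : realType) (H : normedModType R)
    (x : R -> H) (F : set_system R) (l : H) : Prop :=
  forall phi : {linear H -> R^o}, continuous phi ->
    phi (x s) @[s --> F] --> phi l.

(* Main.v *)
Require Import Defs.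
From HB Require Import structures.
From mathcomp Require Import all_boot all_order all_algebra.
From mathcomp Require Import all_classical all_reals all_analysis.
From mathcomp Require Import measurable_realfun ring lra.

(** The second-order equation hides a first-order one.  Put a := alpha - 1 and
    y(s) := x(s) + (s / a) x'(s), the point where the gradient is evaluated.
    The equation says exactly that y' = - (s / a) grad f(y): up to the change
    of time tau = s^2 / (2 a), y is a trajectory of the gradient flow of f, and
    x is recovered from y by x' = (a / s) (y - x), a weighted average of the
    past of y.  So the estimates are first proved for y and then carried to x.

    For y, fix a minimizer z and write gap(s) := f(y(s)) - f(z).
    - The function E(s) := s^2 gap(s) + a |y(s) - z|^2 decreases, with
      E' <= - (s^3 / a) |grad f(y)|^2 ([is_derive_lyapunov], [le_dissipation]).
      As E >= 0, integrating gives (i) ([scaled_gradient_finite_integral]).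
    - Along a gradient flow |grad f(y)| decreases ([gradient_nincr]): the flow
      is a contraction, and the speed is a limit of rescaled distances between a
      trajectory and its own time shifts.  Monotonicity turns the integral
      bound into a pointwise one: s^4 |grad f(y(s))|^2 is at most a multiple of
      E(s/2) - E(s), the amount spent on [s/2, s], which tends to 0 because E
      converges.  This is (ii) ([scaled_gradient_cvg0]); the same argument with
      |y - z|^2 in place of E gives s^2 gap(s) -> 0 ([scaled_gap_cvg0]).
    - The distance of y to every minimizer converges, and every weak limit
      point of y is a minimizer, so y converges weakly by Opial's argument
      ([opial], [flow_weak_cvg]).  Weak limit points are taken along
      ultrafilters: along one of them every bounded real function converges,
      and the Riesz representation theorem turns the resulting functional into
      a vector ([ultra_bounded_weak_cvg]).

    The passage from y to x rests on one scalar fact: if phi >= 0 and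
    s phi' <= - b phi + eta with b > 0 and eta -> 0, then phi -> 0
    ([differential_inequality_cvg0]).  It applies to phi = |y - x|^2, with
    b = a and eta governed by s^2 |grad f(y)|; since y - x = (s / a) x', this
    is (iii), and it carries the weak limit of y over to x, which is (iv).  It
    applies also to phi = s^2 (f(x) - min f), with b = a - 2 and
    eta = a s^2 gap(s), which is (v): this is where alpha > 3 enters. *)

Set Implicit Arguments.
Unset Strict Implicit.
Unset Printing Implicit Defensive.

Import Order.TTheory GRing.Theory Num.Theory.
Import numFieldNormedType.Exports.

Local Open Scope classical_set_scope.
Local Open Scope ring_scope.

(** * Derivatives of functions of a real variable *)
Lemma is_derive1P (R : realType) (V : normedModType R) (u : R -> V) (t : R)
    (du : V) :
  is_derive t 1 u du <->
  h^-1 *: (u (h + t) - u t) @[h --> 0^'] --> du.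
Proof.
have -> : (fun h => h^-1 *: (u (h + t) - u t)) =
    (fun h => h^-1 *: ((u \o shift t) (h *: 1) - u t)).
  by apply/funext => h /=; rewrite [_ *: 1]mulr1.
split=> [[du1 <-]|h]; first exact: du1.
by apply: DeriveDef; [apply/cvg_ex; exists du|exact: cvg_lim h].
Qed.

Lemma is_derive_comp (R : realType) (V W : normedModType R)
    (F : V -> W) (u : R -> V) (s : R) (du : V) :
  differentiable F (u s) -> is_derive s 1 u du ->
  is_derive s 1 (F \o u) ('d F (u s) du).
Proof.
move=> dF hu.
have du1 : differentiable u s.
  by apply/derivable1_diffP; exact: (@ex_derive _ _ _ _ _ _ _ hu).
have dFu : differentiable (F \o u) s by exact: differentiable_comp.
split; first exact: diff_derivable.
rewrite deriveE// diff_comp//=; congr ('d F (u s) _).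
by rewrite -deriveE//; exact: (@derive_val _ _ _ _ _ _ _ hu).
Qed.

Lemma is_derive_reparam (R : realType) (V : normedModType R)
    (u : R -> V) (sigma : R -> R) (s dsigma : R) (du : V) :
  is_derive (sigma s) 1 u du -> is_derive s 1 sigma dsigma ->
  is_derive s 1 (u \o sigma) (dsigma *: du).
Proof.
move=> hu hs.
have du1 : differentiable u (sigma s).
  by apply/derivable1_diffP; exact: (@ex_derive _ _ _ _ _ _ _ hu).
apply: is_derive_eq (is_derive_comp du1 hs) _.
rewrite -[in LHS](mulr1 dsigma) -[dsigma * 1]/(dsigma *: (1 : R^o)) linearZ/=.
by rewrite -deriveE//; congr (_ *: _); exact: (@derive_val _ _ _ _ _ _ _ hu).
Qed.

Lemma is_derive_scale (R : realType) (V : normedModType R) (c : R -> R) (u : R -> V)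
    (s dc : R) (du : V) :
  is_derive s 1 c dc -> is_derive s 1 u du ->
  is_derive s 1 (fun t => c t *: u t) (dc *: u s + c s *: du).
Proof.
move=> hc hu; apply/is_derive1P.
have cu : u (h + s) @[h --> 0^'] --> u s.
  apply/(continuous_withinNshiftx u s).
  by apply/differentiable_continuous/derivable1_diffP; case: hu.
have -> : (fun h => h^-1 *: (c (h + s) *: u (h + s) - c s *: u s)) =
    (fun h => (h^-1 * (c (h + s) - c s)) *: u (h + s) +
              c s *: (h^-1 *: (u (h + s) - u s))).
  apply/funext => h.
  rewrite (scalerA (c s)) (mulrC (c s)) -!scalerA -scalerDr; congr (_ *: _).
  by rewrite scalerBl scalerBr addrA subrK.
apply: cvgD; apply: cvgZ => //.
- by have /is_derive1P := hc.
- exact: cvg_cst.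
- by have /is_derive1P := hu.
Qed.

Lemma is_derive_sub_cst (R : realType) (V : normedModType R) (u : R -> V)
    (s : R) (du c : V) :
  is_derive s 1 u du -> is_derive s 1 (fun t => u t - c) du.
Proof.
by move=> hu; have := is_deriveB hu (is_derive_cst c s 1); rewrite subr0.
Qed.

Lemma is_derive1M (R : realType) (f g : R -> R) (s df dg : R) :
  is_derive s 1 f df -> is_derive s 1 g dg ->
  is_derive s 1 (fun t => f t * g t) (df * g s + f s * dg).
Proof.
move=> hf hg; apply: is_derive_eq (is_deriveM hf hg) _.
by rewrite /GRing.scale/= addrC [df * _]mulrC.
Qed.

Lemma is_derive1X (R : realType) (n : nat) (s : R) :
  is_derive s 1 (fun t : R => t ^+ n.+1) (n.+1%:R * s ^+ n).
Proof.
split; first exact: exprn_derivable.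
by rewrite exp_derive /GRing.scale/= mulr1 mulr_natl.
Qed.

(** * Asymptotics of real functions at infinity *)

Section Asymptotics.
Context (R : realType).
Implicit Types (E dE phi eta : R -> R).

Lemma is_derive_le0_le E dE (a b : R) : a <= b ->
  (forall s : R, a <= s <= b -> is_derive s 1 E (dE s)) ->
  (forall s : R, a < s < b -> dE s <= 0) -> E b <= E a.
Proof.
move=> ab dEE dE0.
have dEab s : s \in `]a, b[ -> is_derive s 1 E (dE s).
  by rewrite in_itv/= => /andP[/ltW as_ /ltW sb]; apply: dEE; rewrite as_.
apply: (@ler0_derive1_le_cc R E a b) => //.
- by move=> s /dEab h; exact: (@ex_derive _ _ _ _ _ _ _ h).
- move=> s sab; rewrite derive1E; rewrite (@derive_val _ _ _ _ _ _ _ (dEab s sab)).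
  by apply: dE0; move: sab; rewrite in_itv.
- by apply: derivable_within_continuous => s; rewrite in_itv/= => /dEE[].
- by rewrite in_itv/= lexx ab.
- by rewrite in_itv/= lexx ab.
Qed.

Lemma nonincr_lbound_cvgr E (a m : R) :
  (forall s t : R, a < s -> s <= t -> E t <= E s) ->
  (forall s : R, a < s -> m <= E s) ->
  exists l : R, E s @[s --> +oo] --> l.
Proof.
move=> Enincr Em; pose A := E @` `]a, +oo[; exists (inf A).
have Aa s : a < s -> A (E s).
  by move=> as_; exists s => //=; rewrite in_itv/= andbT.
have Ainf : has_inf A.
  split; first by exists (E (a + 1)); apply: Aa; rewrite ltrDl.
  by exists m => y [s/=]; rewrite in_itv/= andbT => /Em ? <-.
apply/cvgrPdist_le => e e0.
have [y [s /=]] := inf_adherent e0 Ainf.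
rewrite in_itv/= andbT => as_ <- Es.
near=> t; have st : s <= t by near: t; apply: nbhs_pinfty_ge; exact: num_real.
have at_ : a < t by exact: lt_le_trans st.
rewrite distrC ger0_norm; last first.
  by rewrite subr_ge0 ge_inf//; [exact: Ainf.2|exact: Aa].
by rewrite lerBlDl (le_trans (Enincr _ _ as_ st))// ltW.
Unshelve. all: by end_near. Qed.

Lemma cvgr_sub_half E (l : R) : E s @[s --> +oo] --> l ->
  E (s / 2) - E s @[s --> +oo] --> (0 : R).
Proof.
move=> El; rewrite -[0](subrr l); apply: cvgB => //.
apply: cvg_comp El; apply/cvgryPge => A; near=> s.
by rewrite ler_pdivlMr//; near: s; apply: nbhs_pinfty_ge; exact: num_real.
Unshelve. all: by end_near. Qed.

(** The quantitative form of: a monotone integrand of a convergent integral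
    decays.  Here [E (s / 2) - E s] is what the integral spends on [s/2, s]. *)
Lemma le_sub_half_cvg0 E phi (l C S : R) :
  E s @[s --> +oo] --> l ->
  (forall s : R, S < s -> 0 <= phi s <= C * (E (s / 2) - E s)) ->
  phi s @[s --> +oo] --> (0 : R).
Proof.
move=> El h; apply: (@squeeze_cvgr _ _ _ _ (cst 0) (fun s => C * (E (s / 2) - E s))).
- near=> s; apply: h; near: s; apply: nbhs_pinfty_gt; exact: num_real.
- exact: cvg_cst.
- by rewrite -[0](mulr0 C); apply: cvgM; [exact: cvg_cst|exact: cvgr_sub_half El].
Unshelve. all: by end_near. Qed.

(** Comparison with the Euler equation [s * phi' = - b * phi], whose solutions
    [C * s ^ (- b)] vanish at infinity. *)
Lemma differential_inequality_cvg0 phi dphi eta (b S : R) : 0 < b ->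
  (forall s : R, S < s -> 0 <= phi s) ->
  (forall s : R, S < s -> is_derive s 1 phi (dphi s)) ->
  (forall s : R, S < s -> s * dphi s <= - b * phi s + eta s) ->
  eta s @[s --> +oo] --> (0 : R) -> phi s @[s --> +oo] --> (0 : R).
Proof.
move=> b0 phi0 dphiE ineq eta0; apply/cvgr0Pnorm_le => e e0.
have be : 0 < b * (e / 2) by rewrite mulr_gt0// divr_gt0.
have [T [T0 ST Teta]] : exists T, [/\ 0 < T, S < T &
    forall s, T <= s -> eta s <= b * (e / 2)].
  have [M [_ hM]] := (cvgr0Pnorm_le _).1 eta0 _ be.
  exists (Num.max (Num.max 1 (M + 1)) (S + 1)).
  split.
  - by rewrite !lt_max ltr01.
  - by rewrite !lt_max ltrDl ltr01 orbT.
  - move=> s; rewrite !ge_max => /andP[/andP[_ Ms] _].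
    by apply: le_trans (ler_norm _) (hM _ _); rewrite (lt_le_trans _ Ms)// ltrDl.
(* The integrating factor is s ^ b; subtracting e / 2 absorbs eta <= b e / 2. *)
pose psi s := s `^ b * (phi s - e / 2).
have psi_nincr s : T <= s -> psi s <= psi T.
  move=> Ts.
  apply: (@is_derive_le0_le psi (fun s =>
    b * s `^ (b - 1) * (phi s - e / 2) + s `^ b * dphi s)) => //.
  - move=> r /andP[Tr _]; have r0 : 0 < r by exact: lt_le_trans Tr.
    apply: is_derive1M; first exact: is_derive1_powR.
    have := is_deriveB (dphiE r (lt_le_trans ST Tr)) (is_derive_cst (e / 2) r 1).
    by rewrite subr0.
  - move=> r /andP[/ltW Tr _]; have r0 : 0 < r by exact: lt_le_trans Tr.
    have -> : r `^ b = r `^ (b - 1) * r.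
      by rewrite powRB ?(gt_eqF r0) ?implybT// powRr1 ?ltW// divfK ?gt_eqF.
    have -> : b * r `^ (b - 1) * (phi r - e / 2) + r `^ (b - 1) * r * dphi r =
      r `^ (b - 1) * (b * (phi r - e / 2) + r * dphi r) by ring.
    rewrite mulr_ge0_le0 ?powR_ge0//.
    have := ineq r (lt_le_trans ST Tr); have := Teta r Tr.
    by move: (r * dphi r) (phi r) (eta r) => *; lra.
(* It remains to wait until s ^ b exceeds K, so that psi T / s ^ b <= e / 2. *)
pose K := psi T / (e / 2).
near=> s.
have Ts : T <= s by near: s; apply: nbhs_pinfty_ge; exact: num_real.
have s0 : 0 < s by exact: lt_le_trans Ts.
rewrite ger0_norm; last by apply: phi0; exact: lt_le_trans Ts.
have Ks : `|K| <= s `^ b.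
  have -> : `|K| = (`|K| `^ b^-1) `^ b.
    by rewrite -powRrM mulVf ?gt_eqF// powRr1.
  by apply: ge0_ler_powR; rewrite ?nnegrE ?powR_ge0 ?(ltW s0) ?(ltW b0).
have sb0 : 0 < s `^ b by rewrite powR_gt0.
have := psi_nincr s Ts; have := le_trans (ler_norm K) Ks.
rewrite {1}/K ler_pdivrMr ?divr_gt0// => h1 h2.
by have := le_trans h2 h1; rewrite /psi ler_pM2l//; lra.
Unshelve. all: by end_near. Qed.

Lemma littleo_inv_pow (n : nat) phi :
  s ^+ n * phi s @[s --> +oo] --> (0 : R) ->
  phi =o_+oo (fun s : R => 1 / s ^+ n).
Proof.
move=> /cvgr0Pnorm_le h; apply/eqoP => e e0; near=> s.
have s0 : 0 < s by near: s; apply: nbhs_pinfty_gt; exact: num_real.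
have sn : 0 < s ^+ n by rewrite exprn_gt0.
rewrite div1r normfV (gtr0_norm sn) ler_pdivlMr// mulrC -[X in X * _](gtr0_norm sn).
by rewrite -normrM; near: s; exact: h.
Unshelve. all: by end_near. Qed.

End Asymptotics.

Lemma cvgr0_sqr (R : realType) (T : Type) (F : set_system T) (phi : T -> R) :
  Filter F -> phi t ^+ 2 @[t --> F] --> (0 : R) -> phi t @[t --> F] --> (0 : R).
Proof.
move=> FF /cvgr0Pnorm_le h; apply/cvgr0Pnorm_le => e e0.
have := h _ (exprn_gt0 2 e0); apply: filterS => t.
by rewrite normrX ler_pXn2r// nnegrE ltW.
Qed.

(** * Inner products *)

Section InnerProduct.
Context (R : realType) (H : normedModType R)
  (dot : {dot H for (idfun : R -> R)}) (dotE : norm_from_dot dot).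
Implicit Types u v w : H.

Lemma dotC u v : dot u v = dot v u.
Proof. by have := @hermitian_subproof _ _ _ _ dot u v; rewrite expr0 mul1r. Qed.

Lemma dotBr u v w : dot u (v - w) = dot u v - dot u w.
Proof. exact: (@zmod_morphismr_subproof _ _ _ _ _ _ dot u). Qed.

Lemma dotZr (a : R) u v : dot u (a *: v) = a * dot u v.
Proof. exact: (@linearr_subproof _ _ _ _ _ _ dot u). Qed.

Lemma dotNr u v : dot u (- v) = - dot u v.
Proof. by rewrite -scaleN1r dotZr mulN1r. Qed.

Lemma dotDr u v w : dot u (v + w) = dot u v + dot u w.
Proof. by rewrite -[w]opprK dotBr !dotNr !opprK. Qed.

Lemma dotDl u v w : dot (u + v) w = dot u w + dot v w.
Proof. by rewrite dotC dotDr !(dotC w). Qed.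

Lemma dotBl u v w : dot (u - v) w = dot u w - dot v w.
Proof. by rewrite dotC dotBr !(dotC w). Qed.

Lemma dotZl (a : R) u v : dot (a *: u) v = a * dot u v.
Proof. by rewrite dotC dotZr dotC. Qed.

Lemma sqr_normD u v : `|u + v| ^+ 2 = `|u| ^+ 2 + 2 * dot u v + `|v| ^+ 2.
Proof. by rewrite !dotE dotDl !dotDr (dotC v u); ring. Qed.

Lemma sqr_normB u v : `|u - v| ^+ 2 = `|u| ^+ 2 - 2 * dot u v + `|v| ^+ 2.
Proof. by rewrite sqr_normD normrN dotNr; ring. Qed.

Lemma cauchy_schwarz u v : `|dot u v| <= `|u| * `|v|.
Proof.
have [->|v0] := eqVneq v 0.
  by rewrite normr0 mulr0 -(scale0r 0) dotZr mul0r normr0.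
have vn : 0 < `|v| ^+ 2 by rewrite exprn_gt0// normr_gt0.
have : 0 <= `|u - (dot u v / `|v| ^+ 2) *: v| ^+ 2 by rewrite exprn_ge0.
rewrite sqr_normB dotZr normrZ exprMn real_normK ?num_real//.
have -> : `|u| ^+ 2 - 2 * (dot u v / `|v| ^+ 2 * dot u v)
   + (dot u v / `|v| ^+ 2) ^+ 2 * `|v| ^+ 2
   = (`|u| ^+ 2 * `|v| ^+ 2 - dot u v ^+ 2) / `|v| ^+ 2.
  by field; rewrite normr_eq0.
rewrite pmulr_lge0 ?invr_gt0// subr_ge0 -exprMn => h.
rewrite -(@ler_pXn2r _ 2) ?nnegrE ?mulr_ge0//.
by rewrite real_normK ?num_real.
Qed.

Lemma cvg_dot (T : Type) (F : set_system T) {FF : Filter F} (u v : T -> H)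
    (a b : H) :
  u @ F --> a -> v @ F --> b -> dot (u t) (v t) @[t --> F] --> dot a b.
Proof.
move=> ua vb.
(* By polarization, only the continuity of the norm is needed. *)
have pol p q : dot p q = 2^-1 * (`|p + q| ^+ 2 - `|p| ^+ 2 - `|q| ^+ 2).
  by rewrite sqr_normD; field.
have N (p : T -> H) (l : H) : p @ F --> l ->
    `|p t| ^+ 2 @[t --> F] --> `|l| ^+ 2.
  by move=> pl; rewrite !expr2; apply: cvgM; exact: (cvg_norm pl).
rewrite (pol a b); under eq_fun do rewrite pol.
apply: cvgM; first exact: cvg_cst.
apply: cvgB; [apply: cvgB|]; apply: N => //.
exact: (cvgD ua vb).
Qed.

Lemma is_derive_dot (u v : R -> H) (t : R) (du dv : H) :
  is_derive t 1 u du -> is_derive t 1 v dv ->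
  is_derive t 1 (fun s => dot (u s) (v s)) (dot du (v t) + dot (u t) dv).
Proof.
move=> hu hv; apply/(is_derive1P (fun s => dot (u s) (v s) : R^o)).
have cv : v (h + t) @[h --> 0^'] --> v t.
  apply/(continuous_withinNshiftx v t).
  by apply/differentiable_continuous/derivable1_diffP; case: hv.
have -> : (fun h => h^-1 *: (dot (u (h + t)) (v (h + t)) - dot (u t) (v t))) =
    (fun h => dot (h^-1 *: (u (h + t) - u t)) (v (h + t)) +
              dot (u t) (h^-1 *: (v (h + t) - v t))) :> (R -> R).
  apply/funext => h; rewrite dotZl dotZr dotBl dotBr -mulrDr; congr (_ * _).
  by ring.
apply: cvgD; apply: cvg_dot => //.
- exact/is_derive1P.
- exact: cvg_cst.
- exact/is_derive1P.
Qed.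

Lemma is_derive_sqr_norm (u : R -> H) (t : R) (du : H) :
  is_derive t 1 u du ->
  is_derive t 1 (fun s => `|u s| ^+ 2) (2 * dot (u t) du).
Proof.
move=> hu; rewrite [X in is_derive _ _ X](_ : _ = fun s => dot (u s) (u s)).
  apply: is_derive_eq (is_derive_dot hu hu) _.
  by rewrite (dotC du); ring.
by apply/funext => s; rewrite dotE.
Qed.

End InnerProduct.

(** * The Riesz representation and the gradient *)

Lemma linear_term_eq0 (R : realType) (d k : R) : 0 <= k ->
  (forall t, 0 <= t * d + t ^+ 2 * k) -> d = 0.
Proof.
move=> k0 h; have k1 : 0 < k + 1 by rewrite ltr_wpDl.
have := h (- d / (k + 1)).
have -> : - d / (k + 1) * d + (- d / (k + 1)) ^+ 2 * k = - (d / (k + 1)) ^+ 2.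
  by field; rewrite gt_eqF.
rewrite oppr_ge0 => h'; have : (d / (k + 1)) ^+ 2 == 0.
  by rewrite eq_le h' sqr_ge0.
by rewrite sqrf_eq0 mulf_eq0 invr_eq0 (gt_eqF k1) orbF => /eqP.
Qed.

Section Riesz.
Context (R : realType) (H : completeNormedModType R)
  (dot : {dot H for (idfun : R -> R)}) (dotE : norm_from_dot dot).

(** The representing vector is the minimizer of [J v := |v|^2 / 2 - phi v]: it
    exists because the parallelogram law makes minimizing sequences Cauchy, and
    the first-order condition at it is the desired identity. *)
Lemma riesz (phi : {linear H -> R^o}) : continuous phi ->
  exists g, forall v, phi v = dot g v.
Proof.
move=> cphi; have [k k0 hk] := linear_lipschitz cphi.
have phiZ t v : phi (t *: v) = t * phi v by rewrite linearZ.
pose J v : R := `|v| ^+ 2 / 2 - phi v.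
have Jlb : has_inf (range J).
  split; first by exists (J 0), 0.
  exists (- (k ^+ 2 / 2)) => _ [v _ <-]; rewrite /J.
  have := le_trans (ler_norm _) (hk v).
  have := sqr_ge0 (`|v| - k); nra.
pose m := inf (range J).
have mJ v : m <= J v by apply: ge_inf; [exact: Jlb.2|exists v].
have /choice[v_ hv] : forall n, exists v, J v < m + n.+1%:R^-1.
  move=> n; have [|_ [v _ <-] h] := @inf_adherent R (range J) n.+1%:R^-1 _ Jlb.
    by rewrite invr_gt0.
  by exists v.
have par u v : `|u - v| ^+ 2 <= 4 * (J u + J v - 2 * m).
  have := mJ (2^-1 *: (u + v)); rewrite /J normrZ exprMn ger0_norm ?invr_ge0//.
  rewrite linearZ/= linearD/= (sqr_normD dotE) (sqr_normB dotE) /GRing.scale/=; nra.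
have : cauchy (v_ @ \oo).
  apply/cauchy_exP => e e0.
  have e8 : 0 < e ^+ 2 / 8 by rewrite divr_gt0 ?exprn_gt0.
  have [N _ hN] := near_infty_natSinv_lt (PosNum e8).
  exists (v_ N); exists N => //= n Nn /=; rewrite -ball_normE /ball_/=.
  rewrite -(@ltr_pXn2r _ 2) ?nnegrE ?(ltW e0)//.
  apply: le_lt_trans (par _ _) _.
  have := hN N (leqnn N); have := hN n Nn; have := hv n; have := hv N.
  rewrite /=; move: (n.+1%:R^-1) (N.+1%:R^-1) (J _) (J _).
  by clearbody m; clear => *; lra.
move/cauchy_cvg => /cvg_ex[g vg].
have Jg : J (v_ n) @[n --> \oo] --> J g.
  have c1 : `|v_ n| ^+ 2 / 2 @[n --> \oo] --> `|g| ^+ 2 / 2.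
    apply: cvgM; last exact: cvg_cst.
    by rewrite expr2; apply: cvgM; exact: (cvg_norm vg).
  have c2 : (phi (v_ n) : R) @[n --> \oo] --> (phi g : R).
    exact: (cvg_comp v_ phi vg (cphi g)).
  exact: cvgB c1 c2.
have gm : J g <= m.
  apply/ler_addgt0Pr => e e0.
  apply: (cvgr_to_le Jg); have [N _ hN] := near_infty_natSinv_lt (PosNum e0).
  exists N => //= n Nn; have := hN n Nn; have := hv n.
  by rewrite /=; move: (n.+1%:R^-1) (J _) => *; lra.
exists g => v; apply/eqP; rewrite -subr_eq0; apply/eqP.
apply: (@linear_term_eq0 _ _ (`|v| ^+ 2 / 2)).
  by rewrite divr_ge0 ?exprn_ge0.
move=> t; have := le_trans gm (mJ (g - t *: v)).
rewrite /J (sqr_normB dotE) dotZr linearB/= phiZ.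
rewrite normrZ exprMn real_normK ?num_real//; lra.
Qed.

Lemma gradient_spec (f : H -> R) (y : H) : differentiable f y ->
  forall v, 'd f y v = dot (gradient dot f y) v.
Proof.
move=> /diff_continuous/riesz[g hg].
by have /getPex := ex_intro (fun g => forall v, 'd f y v = dot g v) g hg.
Qed.

Lemma gradient_continuous (f : H -> R) : class_C1 f -> continuous (gradient dot f).
Proof.
move=> [df cdf] y; apply/cvgrPdist_le => e e0.
apply: filterS (cdf y e e0) => z hz; rewrite distrC.
(* Testing the differentials against the difference itself yields its norm. *)
have := hz (gradient dot f z - gradient dot f y).
rewrite !gradient_spec//.
move: (gradient dot f z) (gradient dot f y) => g g'.
rewrite -dotBl -dotE ger0_norm ?sqr_ge0// expr2.
have [->|n0] := eqVneq `|g - g'| 0; first by move=> _; exact: ltW.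
by rewrite ler_pM2r// lt_neqAle eq_sym n0 normr_ge0.
Qed.

Lemma convex_diff_le (f : H -> R) :
  convex_function [set: convex_lmodType H] f ->
  forall y z, differentiable f y -> f y + 'd f y (z - y) <= f z.
Proof.
move=> cf y z df; rewrite -lerBrDl -deriveE//.
have dv : derivable f y (z - y) by exact: diff_derivable.
have /cvg_dnbhs_at_right lim0 :
  h^-1 *: ((f \o shift y) (h *: (z - y)) - f y) @[h --> 0^'] --> 'D_(z - y) f y.
  by exact: dv.
apply: (cvgr_to_le lim0); near=> h.
have h0 : 0 < h by [].
have h1 : h <= 1 by near: h; exact: nbhs_right_le.
rewrite /= [_^-1 *: _]/(_^-1 * _) ler_pdivrMl//.
have -> : h *: (z - y) + y = h *: z + (1 - h) *: y.
  by rewrite scalerBl scale1r scalerBr [RHS]addrCA [RHS]addrC.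
have : f (h *: z + (1 - h) *: y) <= h * f z + (1 - h) * f y.
  by have := cf (Itv01 (ltW h0) h1) z y; rewrite !inE => /(_ Logic.I Logic.I).
by move: (f _) (f z) (f y) => *; lra.
Unshelve. all: by end_near. Qed.

Lemma gradient_convex_le (f : H -> R) :
  convex_function [set: convex_lmodType H] f -> (forall y, differentiable f y) ->
  forall y z, f y + dot (gradient dot f y) (z - y) <= f z.
Proof.
by move=> cf df y z; rewrite -gradient_spec//; exact: convex_diff_le.
Qed.

End Riesz.

Lemma subgradient_monotone (R : realType) (H : normedModType R)
    (dot : {dot H for (idfun : R -> R)}) (f : H -> R) (G : H -> H) :
  (forall y z, f y + dot (G y) (z - y) <= f z) ->
  forall y z, 0 <= dot (G y - G z) (y - z).
Proof.
move=> cf y z; have := cf z y; have := cf y z.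
rewrite dotBl -[y - z]opprB !dotNr.
by move: (dot _ _) (dot _ _) (f y) (f z) => *; lra.
Qed.

(** * Weak convergence along ultrafilters and Opial's lemma *)

Lemma ultra_bounded_cvg (R : realType) (T : Type) (U : set_system T)
    (g : T -> R) (M : R) : UltraFilter U ->
  (\forall t \near U, `|g t| <= M) -> exists l : R, g t @[t --> U] --> l.
Proof.
move=> UU gM.
have gI : fmap g U `[- M, M]%classic.
  by apply: filterS gM => t /=; rewrite in_itv/= ler_norml.
have [l [_ cl]] := @segment_compact R (- M) M _ _ gI.
exists l => B Bl.
have [//|UnB] := in_ultra_setVsetC (g @^-1` B) UU.
by have [r [nBr Br]] := cl (~` B) B UnB Bl.
Qed.

Section Opial.
Context (R : realType) (H : completeNormedModType R)
  (dot : {dot H for (idfun : R -> R)}) (dotE : norm_from_dot dot)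
  (T : Type).
Implicit Types (F U : set_system T) (y : T -> H).

(** Weak compactness of balls: the limits of [dot (y t) v] along the ultrafilter
    form a bounded linear functional of [v], hence an inner product. *)
Lemma ultra_bounded_weak_cvg U y (M : R) : UltraFilter U ->
  (\forall t \near U, `|y t| <= M) ->
  exists c, forall v, dot (y t) v @[t --> U] --> dot c v.
Proof.
move=> UU yM.
have /choice[l hl] v : exists l : R, dot (y t) v @[t --> U] --> l.
  apply: (@ultra_bounded_cvg _ _ _ _ (M * `|v|)).
  apply: filterS yM => t yt; apply: le_trans (cauchy_schwarz dotE _ _) _.
  by rewrite ler_wpM2r.
have lin : linear_for *%R l.
  move=> a u v; apply: (cvg_unique (@Rhausdorff R) (hl _)).
  have -> : (fun t => dot (y t) (a *: u + v)) =
      (fun t => a * dot (y t) u + dot (y t) v).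
    by apply/funext => t; rewrite dotDr dotZr.
  by apply: cvgD => //; apply: cvgM => //; exact: cvg_cst.
pose phi : {linear H -> R^o} := HB.pack l (GRing.isLinear.Build _ _ _ _ l lin).
have cphi : continuous phi.
  apply: bounded_linear_continuous; exists M; split; first exact: num_real.
  move=> N MN; near=> v => /=.
  have v1 : `|v| <= 1.
    near: v; apply/nbhs_ballP; exists 1 => //= w.
    by rewrite -ball_normE/= sub0r normrN => /ltW.
  apply: le_trans (ltW MN).
  apply: (cvgr_to_le (cvg_norm (hl v))).
  apply: filterS yM => t yt; apply: le_trans (cauchy_schwarz dotE _ _) _.
  have M0 : 0 <= M by exact: le_trans yt.
  by rewrite -[leRHS]mulr1 ler_pM.
have [c hc] := riesz dotE cphi.
by exists c => v; rewrite -hc; exact: hl.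
Unshelve. all: by end_near. Qed.

(** The difference of [|y - c|^2] and [|y - c'|^2] is affine in [dot y (c - c')],
    so this inner product has the same limit along [U] and along [U']; that is,
    [dot c (c - c') = dot c' (c - c')]. *)
Lemma opial_unique F U U' y (c c' : H) : ProperFilter U -> ProperFilter U' ->
  F `<=` U -> F `<=` U' ->
  cvg (`|y t - c| ^+ 2 @[t --> F]) -> cvg (`|y t - c'| ^+ 2 @[t --> F]) ->
  (forall v, dot (y t) v @[t --> U] --> dot c v) ->
  (forall v, dot (y t) v @[t --> U'] --> dot c' v) -> c = c'.
Proof.
move=> PU PU' FU FU' /cvg_ex[l hl] /cvg_ex[l' hl'] yc yc'.
apply/eqP; rewrite -subr_eq0 -normr_eq0 -sqrf_eq0 dotE dotBl subr_eq0; apply/eqP.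
have key (W : set_system T) : F `<=` W -> Filter W ->
    dot (y t) (c - c') @[t --> W] --> (l' - l + `|c| ^+ 2 - `|c'| ^+ 2) / 2.
  move=> FW FFW.
  have e t : dot (y t) (c - c') =
      (`|y t - c'| ^+ 2 - `|y t - c| ^+ 2 + `|c| ^+ 2 - `|c'| ^+ 2) / 2.
    by rewrite !(sqr_normB dotE) dotBr; field.
  under eq_fun do rewrite e.
  have hlW : `|y t - c| ^+ 2 @[t --> W] --> l
    by apply: cvg_trans hl; apply: cvg_app.
  have hlW' : `|y t - c'| ^+ 2 @[t --> W] --> l'
    by apply: cvg_trans hl'; apply: cvg_app.
  apply: cvgM; last exact: cvg_cst.
  by apply: cvgB; last exact: cvg_cst; apply: cvgD; last exact: cvg_cst; exact: cvgB.
have k := key U FU (@filter_filter _ _ PU).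
have k' := key U' FU' (@filter_filter _ _ PU').
rewrite (cvg_unique (@Rhausdorff R) (yc _) k).
by rewrite (cvg_unique (@Rhausdorff R) (yc' _) k').
Qed.

(** If [y] failed to converge weakly to its limit [c] along one ultrafilter, some
    ultrafilter finer than [F] would avoid a neighborhood of the limit when
    tested against some [v]; its own weak limit would then differ from [c],
    against [opial_unique]. *)
Lemma opial F y (S : set H) : ProperFilter F -> S !=set0 ->
  (forall z, S z -> cvg (`|y t - z| ^+ 2 @[t --> F])) ->
  (forall U c, UltraFilter U -> F `<=` U ->
    (forall v, dot (y t) v @[t --> U] --> dot c v) -> S c) ->
  exists2 l, S l & forall v, dot (y t) v @[t --> F] --> dot l v.
Proof.
move=> PF [z Sz] cS clS.
have [M yM] : exists M, \forall t \near F, `|y t| <= M.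
  have /cvg_ex[l hl] := cS _ Sz.
  exists (l + 1 + 1 + `|z|); have /cvgr_le/(_ (l + 1)) := hl.
  rewrite ltrDl ltr01 => /(_ isT); apply: filterS => t ht.
  have : `|y t| <= `|y t - z| + `|z| by rewrite -{1}(subrK z (y t)) ler_normD.
  have := sqr_ge0 (`|y t - z| - 1); have := normr_ge0 (y t - z).
  by move: ht; move: (`|y t - z|) (`|y t|) (`|z|) => *; nra.
have wk U : UltraFilter U -> F `<=` U ->
    exists c, forall v, dot (y t) v @[t --> U] --> dot c v.
  by move=> UU FU; apply: ultra_bounded_weak_cvg (FU _ yM).
have [U [UU FU]] := ultraFilterLemma PF.
have [c hc] := wk U UU FU; have Sc := clS U c UU FU hc.
exists c => // v B Bv; apply: contrapT => nFB.
pose A := (fun t => dot (y t) v) @^-1` B.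
have PW : ProperFilter (within (~` A) F).
  split; last exact: within_filter.
  rewrite /within/= => h; apply: nFB; apply: filterS h => t h.
  by apply: contrapT => /h.
have [V [VU WV]] := ultraFilterLemma PW.
have FV : F `<=` V.
  by apply: subset_trans WV => P FP; apply: filterS FP.
have [d hd] := wk V VU FV; have Sd := clS V d VU FV hd.
have cd : c = d by apply: opial_unique FU FV (cS _ Sc) (cS _ Sd) hc hd.
have VA : V A by rewrite cd in Bv; exact: hd Bv.
have VnA : V (~` A) by apply: WV; apply: withinT.
have VF : Filter V by exact: filter_filter.
by have /filter_ex[t []] : V (A `&` ~` A) by exact: filterI.
Qed.

End Opial.

(** * The gradient flow in rescaled time *)

Section GradientFlow.
Context (R : realType) (H : normedModType R)
  (dot : {dot H for (idfun : R -> R)}) (dotE : norm_from_dot dot)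
  (f : H -> R) (G : H -> H)
  (dfG : forall y, differentiable f y /\ forall v, 'd f y v = dot (G y) v)
  (subG : forall y z, f y + dot (G y) (z - y) <= f z)
  (z0 : H) (z0_min : forall z, f z0 <= f z)
  (a s0 : R) (a0 : 0 < a) (s0_gt0 : 0 < s0).

(** In the time [tau = s ^+ 2 / (2 * a)] this is the gradient flow
    [y' = - G y]. *)
Definition rescaled_flow (y : R -> H) :=
  forall s : R, s0 < s -> is_derive s 1 y (- (s / a) *: G (y s)).

Lemma is_derive_gradient (u : R -> H) (s : R) (du : H) :
  is_derive s 1 u du -> is_derive s 1 (f \o u) (dot (G (u s)) du).
Proof.
by move=> hu; rewrite -(dfG (u s)).2; apply: is_derive_comp => //; exact: (dfG _).1.
Qed.

Let pos_time s : s0 < s -> 0 < s. Proof. exact: lt_trans. Qed.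

(** The derivative of [|u - v|^2] is [- 2 (s / a) * dot (G u - G v) (u - v)], and
    [G] is monotone. *)
Lemma flow_contraction (u v : R -> H) s t :
  rescaled_flow u -> rescaled_flow v -> s0 < s -> s <= t ->
  `|u t - v t| ^+ 2 <= `|u s - v s| ^+ 2.
Proof.
move=> hu hv hs st.
have mono := subgradient_monotone subG.
apply: (@is_derive_le0_le _ (fun r => `|u r - v r| ^+ 2) (fun r =>
  - (2 * (r / a)) * dot (G (u r) - G (v r)) (u r - v r)) _ _ st) => r /andP[sr _].
  have hr : s0 < r by exact: lt_le_trans sr.
  apply: is_derive_eq (is_derive_sqr_norm dotE (is_deriveB (hu r hr) (hv r hr))) _.
  by rewrite -scalerBr dotZr dotC; move: (dot _ _) (r / a) => d c; ring.
rewrite mulNr oppr_le0 mulr_ge0// mulr_ge0// divr_ge0 ?(ltW a0)//.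
exact/ltW/(lt_trans (pos_time hs)).
Qed.

(** Replacing [s] by [sqrt (s ^+ 2 + h)] adds a constant to the time
    [s ^+ 2 / (2 * a)], in which the flow is autonomous. *)
Lemma flow_time_shift (y : R -> H) h : rescaled_flow y -> 0 <= h ->
  rescaled_flow (fun s => y (Num.sqrt (s ^+ 2 + h))).
Proof.
move=> flow h0 s hs; have s_gt0 := pos_time hs.
have sh : 0 < s ^+ 2 + h by rewrite ltr_wpDr// exprn_gt0.
have ss : s <= Num.sqrt (s ^+ 2 + h).
  by rewrite -[leLHS]ger0_norm ?(ltW s_gt0)// -sqrtr_sqr ler_wsqrtr// lerDl.
have r0 : 0 < Num.sqrt (s ^+ 2 + h) by exact: lt_le_trans ss.
have d1 : is_derive s 1 (fun t : R => t ^+ 2 + h) (2 * s).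
  by have := is_deriveD (is_derive1X 1 s) (is_derive_cst h s 1); rewrite addr0.
have d2 : is_derive s 1 (Num.sqrt \o (fun t : R => t ^+ 2 + h))
    (s / Num.sqrt (s ^+ 2 + h)).
  apply: is_derive_eq (@is_derive1_comp _ Num.sqrt (fun t : R => t ^+ 2 + h) s _ _
    (is_derive1_sqrt sh) d1) _.
  by field; rewrite gt_eqF.
have d3 := @is_derive_reparam _ _ y (Num.sqrt \o (fun t : R => t ^+ 2 + h)) s _ _
  (flow _ (lt_le_trans hs ss)) d2.
apply: is_derive_eq d3 _; rewrite scalerA; congr (_ *: _).
by field; rewrite !gt_eqF.
Qed.

(** By contraction, the distance from [y] to its time shift by [h] decreases;
    divided by [h], it tends to a fixed multiple of [|G y|] as [h] tends to
    [0]. *)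
Lemma gradient_nincr (y : R -> H) s t : rescaled_flow y -> s0 < s -> s <= t ->
  `|G (y t)| <= `|G (y s)|.
Proof.
move=> flow hs st.
have lim r : s0 < r -> `|h^-1 *: (y (Num.sqrt (r ^+ 2 + h)) - y r)| @[h --> 0^'+] -->
    `|- (2 * a)^-1 *: G (y r)|.
  move=> hr; have r0 := pos_time hr.
  have d1 : is_derive (0 : R) 1 (fun h : R => r ^+ 2 + h) 1.
    have := is_deriveD (is_derive_cst (r ^+ 2) (0 : R) 1) (is_derive_id (0 : R) 1).
    by rewrite add0r.
  have sq : 0 < r ^+ 2 + 0 by rewrite addr0 exprn_gt0.
  have d2 := @is_derive1_comp _ Num.sqrt (fun h : R => r ^+ 2 + h) 0 _ _
    (is_derive1_sqrt sq) d1.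
  have sr : Num.sqrt (r ^+ 2 + 0) = r by rewrite addr0 sqrtr_sqr ger0_norm ?ltW.
  have d3 : is_derive (0 : R) 1 (fun h => y (Num.sqrt (r ^+ 2 + h)))
      (- (2 * a)^-1 *: G (y r)).
    have hy : is_derive ((Num.sqrt \o (fun h : R => r ^+ 2 + h)) 0) 1 y
        (- (r / a) *: G (y r)).
      by rewrite /= sr; exact: flow.
    apply: is_derive_eq (@is_derive_reparam _ _ y
      (Num.sqrt \o (fun h : R => r ^+ 2 + h)) 0 _ _ hy d2) _.
    rewrite scalerA /= sr; congr (_ *: _).
    by field; rewrite !gt_eqF.
  apply: cvg_norm; apply: cvg_dnbhs_at_right.
  have /is_derive1P := d3; apply: cvg_trans; apply: near_eq_cvg; near=> h.
  by rewrite addr0 sr.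
have : `|- (2 * a)^-1 *: G (y t)| <= `|- (2 * a)^-1 *: G (y s)|.
  apply: (ler_cvg_to (lim t (lt_le_trans hs st)) (lim s hs)); near=> h.
  have h0 : 0 < h by [].
  rewrite !normrZ ler_wpM2l//.
  rewrite -(@ler_pXn2r _ 2) ?nnegrE//.
  exact: (flow_contraction (flow_time_shift flow (ltW h0)) flow).
rewrite !normrZ ler_pM2l// normr_gt0 oppr_eq0 invr_eq0 gt_eqF//.
by rewrite mulr_gt0.
Unshelve. all: by end_near. Qed.

Section Trajectory.
Variables (y : R -> H) (flow : rescaled_flow y).

Lemma is_derive_gap s : s0 < s ->
  is_derive s 1 (fun t => f (y t) - f z0) (- (s / a) * `|G (y s)| ^+ 2).
Proof.
move=> hs; have := is_derive_sub_cst (f z0) (is_derive_gradient (flow hs)).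
by rewrite dotZr -dotE.
Qed.

Lemma is_derive_sqr_dist s z : s0 < s ->
  is_derive s 1 (fun t => `|y t - z| ^+ 2)
    (- (2 * s / a) * dot (G (y s)) (y s - z)).
Proof.
move=> hs; have dyz := is_derive_sub_cst z (flow hs).
apply: is_derive_eq (is_derive_sqr_norm dotE dyz) _.
rewrite dotZr dotC; move: (dot _ _) => d; field.
by rewrite gt_eqF.
Qed.

Lemma gap_le_dot s z : f (y s) - f z <= dot (G (y s)) (y s - z).
Proof.
have := subG (y s) z; rewrite -(opprB (y s)) dotNr.
by move: (dot _ _) => d; lra.
Qed.

Lemma gap_ge0 s : 0 <= f (y s) - f z0. Proof. by rewrite subr_ge0. Qed.

Lemma gap_nincr s t : s0 < s -> s <= t -> f (y t) - f z0 <= f (y s) - f z0.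
Proof.
move=> hs st; apply: (@is_derive_le0_le _ (fun r => f (y r) - f z0)
    (fun r => - (r / a) * `|G (y r)| ^+ 2) _ _ st) => r /andP[sr _].
  by apply: is_derive_gap; exact: lt_le_trans sr.
rewrite mulNr oppr_le0 mulr_ge0 ?exprn_ge0// divr_ge0 ?ltW//.
exact: lt_trans (pos_time hs) sr.
Qed.

Lemma sqr_dist_nincr z s t : (forall w, f z <= f w) ->
  s0 < s -> s <= t -> `|y t - z| ^+ 2 <= `|y s - z| ^+ 2.
Proof.
move=> zmin hs st; apply: (@is_derive_le0_le _ (fun r => `|y r - z| ^+ 2)
    (fun r => - (2 * r / a) * dot (G (y r)) (y r - z)) _ _ st) => r /andP[sr _].
  by apply: is_derive_sqr_dist; exact: lt_le_trans sr.
rewrite mulNr oppr_le0 mulr_ge0 ?divr_ge0 ?mulr_ge0 ?(ltW a0)//.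
  exact/ltW/(lt_trans (pos_time hs)).
by apply: le_trans (gap_le_dot _ _); rewrite subr_ge0.
Qed.

Lemma sqr_dist_cvg z : (forall w, f z <= f w) ->
  cvg (`|y s - z| ^+ 2 @[s --> +oo]).
Proof.
move=> zmin; apply/cvg_ex; apply: (@nonincr_lbound_cvgr _ _ s0 0).
- by move=> s t; exact: sqr_dist_nincr.
- by move=> s _; exact: exprn_ge0.
Qed.

(** With [tau = s ^+ 2 / (2 * a)], this is [2 * a] times the usual energy
    [tau * gap + |y - z0|^2 / 2] of a gradient flow. *)
Definition lyapunov s := s ^+ 2 * (f (y s) - f z0) + a * `|y s - z0| ^+ 2.

(** The second term is nonnegative by convexity of [f]. *)
Definition dissipation s := s ^+ 3 / a * `|G (y s)| ^+ 2 +
  2 * s * (dot (G (y s)) (y s - z0) - (f (y s) - f z0)).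

Lemma is_derive_lyapunov s : s0 < s ->
  is_derive s 1 lyapunov (- dissipation s).
Proof.
move=> hs.
have d1 := is_derive1M (is_derive1X 1 s) (is_derive_gap hs).
have d2 := is_derive1M (is_derive_cst a s 1) (is_derive_sqr_dist z0 hs).
apply: is_derive_eq (is_deriveD d1 d2) _.
rewrite /dissipation /= expr1; move: (dot _ _) (f _) (`|G _|) (`|_ - _|) => d g n m.
by field; rewrite gt_eqF.
Qed.

Lemma le_dissipation s : 0 <= s ->
  s ^+ 3 / a * `|G (y s)| ^+ 2 <= dissipation s.
Proof.
move=> s_ge0; rewrite lerDl mulr_ge0 ?mulr_ge0//.
by rewrite subr_ge0; exact: gap_le_dot.
Qed.

Lemma lyapunov_ge0 s : 0 <= lyapunov s.
Proof.
by apply: addr_ge0; apply: mulr_ge0; rewrite ?gap_ge0 ?sqr_ge0 ?(ltW a0).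
Qed.

Lemma dissipation_ge0 s : 0 <= s -> 0 <= dissipation s.
Proof.
move=> h; apply: le_trans (le_dissipation h).
by rewrite mulr_ge0 ?exprn_ge0// divr_ge0 ?(ltW a0) ?exprn_ge0.
Qed.

Lemma lyapunov_cvg : exists l : R, lyapunov s @[s --> +oo] --> l.
Proof.
apply: (@nonincr_lbound_cvgr _ _ s0 0) => [s t hs st|s _]; last exact: lyapunov_ge0.
apply: (@is_derive_le0_le _ lyapunov (fun r => - dissipation r) _ _ st)
  => r /andP[sr _].
  by apply: is_derive_lyapunov; exact: lt_le_trans sr.
by rewrite oppr_le0 dissipation_ge0// ltW// (lt_trans (pos_time hs)).
Qed.

(** As [gap] decreases, [a * |y - z0|^2] loses at least
    [2 * r * gap s] per unit of time at [r <= s], hence at least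
    [(s ^+ 2 - (s / 2) ^+ 2) * gap s] over [s/2, s]. *)
Lemma scaled_gap_cvg0 : s ^+ 2 * (f (y s) - f z0) @[s --> +oo] --> (0 : R).
Proof.
have /cvg_ex[l Ql] := sqr_dist_cvg z0_min.
have aQl : a * `|y s - z0| ^+ 2 @[s --> +oo] --> a * l.
  by apply: cvgM => //; exact: cvg_cst.
apply: (@le_sub_half_cvg0 _ _ _ _ (4 / 3) (2 * s0) aQl) => s hs.
have s0s : s0 < s / 2 by rewrite ltr_pdivlMr// mulrC.
have hs2 : 0 < s / 2 by exact: lt_trans s0s.
have s_ge : s / 2 <= s by lra.
pose g := f (y s) - f z0.
have g0 : 0 <= g by rewrite subr_ge0.
rewrite mulr_ge0 ?sqr_ge0//=.
have : a * `|y s - z0| ^+ 2 + s ^+ 2 * g <=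
       a * `|y (s / 2) - z0| ^+ 2 + (s / 2) ^+ 2 * g.
  apply: (@is_derive_le0_le _ (fun r => a * `|y r - z0| ^+ 2 + r ^+ 2 * g)
    (fun r => - (2 * r * (dot (G (y r)) (y r - z0) - g))) _ _ s_ge)
    => r /andP[sr rs].
    have hr : s0 < r by exact: lt_le_trans sr.
    have d1 := is_derive1M (is_derive_cst a r 1) (is_derive_sqr_dist z0 hr).
    have d2 := is_derive1M (is_derive1X 1 r) (is_derive_cst g r 1).
    apply: is_derive_eq (is_deriveD d1 d2) _.
    rewrite /cst/= expr1; move: (dot _ _) (`|_ - _|) => d m.
    by field; rewrite gt_eqF.
  rewrite oppr_le0 mulr_ge0 ?mulr_ge0 ?(ltW (lt_trans hs2 sr))// subr_ge0.
  apply: le_trans (gap_le_dot _ _).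
  by apply: gap_nincr (ltW rs); exact: lt_trans sr.
rewrite -/g /=; set m := `|_|; set n := `|_|; clearbody g m n; lra.
Qed.

(** As [|G y|] decreases, [lyapunov] loses at least
    [r ^+ 3 / a * |G (y s)|^2] per unit of time at [r <= s], hence at least
    [(s ^+ 4 - (s / 2) ^+ 4) / (4 * a) * |G (y s)|^2] over [s/2, s]. *)
Lemma scaled_gradient_cvg0 : s ^+ 2 * `|G (y s)| @[s --> +oo] --> (0 : R).
Proof.
have [l El] := lyapunov_cvg.
apply: cvgr0_sqr.
apply: (@le_sub_half_cvg0 _ _ _ _ (64 / 15 * a) (2 * s0) El) => s hs.
have s0s : s0 < s / 2 by rewrite ltr_pdivlMr// mulrC.
have hs2 : 0 < s / 2 by exact: lt_trans s0s.
have s_ge : s / 2 <= s by lra.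
rewrite sqr_ge0/=.
pose n := `|G (y s)| ^+ 2 / (4 * a).
have : lyapunov s + s ^+ 4 * n <= lyapunov (s / 2) + (s / 2) ^+ 4 * n.
  apply: (@is_derive_le0_le _ (fun r => lyapunov r + r ^+ 4 * n)
    (fun r => - dissipation r + 4 * r ^+ 3 * n) _ _ s_ge)
    => r /andP[sr rs].
    have hr : s0 < r by exact: lt_le_trans sr.
    have d2 := is_derive1M (is_derive1X 3 r) (is_derive_cst n r 1).
    apply: is_derive_eq (is_deriveD (is_derive_lyapunov hr) d2) _.
    by rewrite mulr0 addr0.
  have r0 : 0 < r by exact: lt_trans sr.
  rewrite addrC subr_le0; apply: le_trans (le_dissipation (ltW r0)).
  have -> : 4 * r ^+ 3 * n = r ^+ 3 / a * `|G (y s)| ^+ 2.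
    by rewrite /n; field; rewrite gt_eqF.
  rewrite ler_wpM2l ?divr_ge0 ?exprn_ge0 ?(ltW r0) ?(ltW a0)//.
  rewrite ler_pXn2r ?nnegrE//.
  by apply: (gradient_nincr flow) (ltW rs); exact: lt_trans sr.
have -> : (s ^+ 2 * `|G (y s)|) ^+ 2 = s ^+ 4 * n * (4 * a).
  by rewrite /n; field; rewrite gt_eqF.
clearbody n; move: (lyapunov _) (lyapunov _) => e2 e1 h.
have : (15 / 16) * (s ^+ 4 * n) <= e2 - e1 by move: h; lra.
move: (s ^+ 4 * n) => X hX; rewrite -subr_ge0.
have -> : 64 / 15 * a * (e2 - e1) - X * (4 * a) =
    64 / 15 * a * (e2 - e1 - 15 / 16 * X) by field.
by rewrite !mulr_ge0 ?subr_ge0 ?(ltW a0).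
Qed.

Section Integral.
Context (cy : {within `[s0, +oo[, continuous y})
  (cG : {within `[s0, +oo[, continuous (G \o y)}).

Local Notation D := (`[s0, +oo[%classic : set R).

Let cf : {within D, continuous (f \o y)}.
Proof.
apply: within_continuous_comp cy => z _.
by apply: differentiable_continuous; exact: (dfG _).1.
Qed.

Let cid n : {within D, continuous (fun s : R => s ^+ n)}.
Proof. by apply: continuous_subspaceT => s; exact: exprn_continuous. Qed.

Let csqr_norm (c : H) : continuous (fun u : H => `|u - c| ^+ 2).
Proof.
move=> u; have cn : `|w - c| @[w --> u] --> `|u - c|.
  by apply: cvg_norm; apply: cvgB; [exact: cvg_id|exact: cvg_cst].
exact: (cvgM cn cn).
Qed.

Let csqrG : {within D, continuous (fun s => `|G (y s)| ^+ 2)}.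
Proof.
have -> : (fun s => `|G (y s)| ^+ 2) = (fun u : H => `|u - 0| ^+ 2) \o (G \o y).
  by apply/funext => s; rewrite /= subr0.
exact: within_continuous_comp (in1W (@csqr_norm 0)) cG.
Qed.

Let cgrad : {within D, continuous (fun s : R => s ^+ 3 * `|G (y s)| ^+ 2)}.
Proof. by move=> s; apply: cvgM; [exact: cid|exact: csqrG]. Qed.

Let cdissip : {within D, continuous (dissipation)}.
Proof.
move=> s; apply: cvgD.
  apply: cvgM; last exact: csqrG.
  by apply: cvgM; [exact: cid|exact: cvg_cst].
apply: cvgM; first by apply: cvgM; [exact: cvg_cst|exact: (@cid 1)].
apply: cvgB; last by apply: cvgB; [exact: cf|exact: cvg_cst].
apply: (cvg_dot dotE); first exact: cG.
by apply: cvgB; [exact: cy|exact: cvg_cst].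
Qed.

Let clyap : {within D, continuous (lyapunov)}.
Proof.
move=> s; apply: cvgD.
  by apply: cvgM; [exact: cid|apply: cvgB; [exact: cf|exact: cvg_cst]].
apply: cvgM; first exact: cvg_cst.
exact: (within_continuous_comp _ _ _ (in1W (@csqr_norm z0)) cy).
Qed.

(** The integrand is at most [a * dissipation], whose integral is the total
    decrease of [a * lyapunov] by the fundamental theorem of calculus. *)
Lemma scaled_gradient_finite_integral :
  (\int[@lebesgue_measure R]_(s in `[s0, +oo[)
     (s ^+ 3 * `|G (y s)| ^+ 2)%:E < +oo)%E.
Proof.
have [l El] := lyapunov_cvg.
have pos s : s0 <= s -> 0 <= s by move=> h; exact/ltW/(lt_le_trans s0_gt0).
pose E := lyapunov; pose d := dissipation.
have dE s : s0 < s -> is_derive s 1 (fun s => - (a * E s)) (a * d s).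
  move=> hs.
  have d1 := is_derive1M (is_derive_cst a s 1) (is_derive_lyapunov hs).
  by apply: is_derive_eq (is_deriveN d1) _; rewrite mul0r add0r mulrN opprK.
have ftc : (\int[@lebesgue_measure R]_(s in `[s0, +oo[) (a * d s)%:E =
    (- (a * l))%:E - (- (a * E s0))%:E)%E.
  apply: (@ge0_continuous_FTC2y _ (fun s => a * d s) (fun s => - (a * E s))).
  - move=> s hs; rewrite mulr_ge0 ?(ltW a0)//.
    by apply: dissipation_ge0 => //; exact: pos.
  - by move=> s; apply: cvgM; [exact: cvg_cst|exact: cdissip].
  - by apply: cvgN; apply: cvgM => //; exact: cvg_cst.
  - by move=> s /dE h; exact: (@ex_derive _ _ _ _ _ _ _ h).
  - apply: cvgN; apply: cvgM; first exact: cvg_cst.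
    by have [_] := (continuous_within_itvcyP _ _).1 clyap.
  - move=> s; rewrite in_itv/= andbT => /dE h.
    by rewrite derive1E; exact: (@derive_val _ _ _ _ _ _ _ h).
apply: (@le_lt_trans _ _
  (\int[@lebesgue_measure R]_(s in `[s0, +oo[) (a * d s)%:E)%E);
  last by rewrite ftc ltry.
apply: ge0_le_integral => //.
- move=> s /=; rewrite in_itv/= andbT => hs.
  by rewrite lee_fin mulr_ge0 ?exprn_ge0// pos.
- apply/measurable_EFinP; exact: subspace_continuous_measurable_fun cgrad.
- apply/measurable_EFinP; apply: subspace_continuous_measurable_fun => // s.
  by apply: cvgM; [exact: cvg_cst|exact: cdissip].
- move=> s /=; rewrite in_itv/= andbT => hs; rewrite lee_fin.
  rewrite -ler_pdivrMl//; apply: le_trans (le_dissipation (pos _ hs)).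
  by rewrite mulrA [a^-1 * _]mulrC.
Qed.

End Integral.

End Trajectory.

End GradientFlow.

Section FlowWeak.
Context (R : realType) (H : completeNormedModType R)
  (dot : {dot H for (idfun : R -> R)}) (dotE : norm_from_dot dot)
  (f : H -> R) (G : H -> H)
  (dfG : forall y, differentiable f y /\ forall v, 'd f y v = dot (G y) v)
  (subG : forall y z, f y + dot (G y) (z - y) <= f z)
  (f_argmin : argmin f !=set0)
  (a s0 : R) (a0 : 0 < a) (s0_gt0 : 0 < s0)
  (y : R -> H) (flow : rescaled_flow G a s0 y).

Lemma flow_weak_cvg : exists2 l, argmin f l &
  forall v, dot (y s) v @[s --> +oo] --> dot l v.
Proof.
apply: (opial dotE) => // [z z_min|U c UU FU yc].
  exact: (sqr_dist_cvg dotE subG a0 s0_gt0 flow z_min).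
have [z0 z0_min] := f_argmin.
have gap0 : f (y s) - f z0 @[s --> +oo] --> (0 : R).
  have sgap := scaled_gap_cvg0 dotE dfG subG z0_min a0 s0_gt0 flow.
  apply: (squeeze_cvgr _ (cvg_cst (0 : R)) sgap).
  near=> s; rewrite subr_ge0 z0_min/= ler_peMl ?subr_ge0//.
  by rewrite expr_ge1.
move=> z; apply: le_trans (z0_min z).
have fy : f (y s) @[s --> U] --> f z0.
  have : f (y s) @[s --> +oo] --> f z0.
    rewrite -[f z0]add0r; under eq_fun do rewrite -[f (y _)](subrK (f z0)).
    by apply: cvgD => //; exact: cvg_cst.
  by apply: cvg_trans; apply: cvg_app.
(* The affine minorant of f at the weak limit c passes to the limit. *)
have dy : f c + (dot (y s) (G c) - dot c (G c)) @[s --> U] -->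
    f c + (dot c (G c) - dot c (G c)).
  apply: cvgD; first exact: cvg_cst.
  by apply: cvgB; [exact: yc|exact: cvg_cst].
rewrite subrr addr0 in dy.
apply: (ler_cvg_to dy fy); near=> s.
by rewrite -dotBl dotC; exact: subG.
Unshelve. all: by end_near. Qed.

End FlowWeak.

(** * From the flow to the second-order dynamics *)

Section Dynamics.
Context (R : realType) (H : completeNormedModType R)
  (dot : {dot H for (idfun : R -> R)}) (dotE : norm_from_dot dot)
  (f : H -> R) (G : H -> H)
  (dfG : forall y, differentiable f y /\ forall v, 'd f y v = dot (G y) v)
  (subG : forall y z, f y + dot (G y) (z - y) <= f z)
  (z0 : H) (z0_min : forall z, f z0 <= f z)
  (a s0 : R) (a0 : 0 < a) (s0_gt0 : 0 < s0).
Variables (x v acc : R -> H).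
Hypotheses (dx : forall s : R, s0 < s -> is_derive s 1 x (v s))
  (dv : forall s : R, s0 < s -> is_derive s 1 v (acc s)).

(** The point at which the equation evaluates the gradient; [a] stands for
    [alpha - 1]. *)
Definition lookahead s : H := x s + (s / a) *: v s.

Hypothesis (ode : forall s, s0 <= s ->
  acc s + ((a + 1) / s) *: v s + G (lookahead s) = 0).

Local Notation y := lookahead.

Let pos s : s0 < s -> 0 < s. Proof. exact: lt_trans. Qed.

Let dcoef s : is_derive s (1 : R) (fun t : R => t / a) a^-1.
Proof.
have := is_derive1M (is_derive_id s (1 : R)) (is_derive_cst a^-1 s (1 : R)).
by rewrite mul1r mulr0 addr0.
Qed.

(** Differentiating [x + (s / a) v], the terms in [v] cancel because the damping
    coefficient is [a + 1]: [1 + 1 / a - (a + 1) / a = 0]. *)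
Lemma lookahead_flow : rescaled_flow G a s0 y.
Proof.
move=> s hs.
have := is_deriveD (dx hs) (is_derive_scale (dcoef s) (dv hs)).
have -> : acc s = - (((a + 1) / s) *: v s) - G (y s).
  by apply/eqP; rewrite -subr_eq0 opprD !opprK addrA; apply/eqP/ode/ltW.
move=> h; apply: is_derive_eq h _.
rewrite scalerBr scalerN scalerA addrA addrA.
have -> : v s + a^-1 *: v s - (s / a * ((a + 1) / s)) *: v s = 0.
  rewrite -[X in X + _ - _]scale1r -scalerDl -scalerBl (_ : _ - _ = 0) ?scale0r//.
  by field; rewrite (gt_eqF a0) gt_eqF// pos.
by rewrite add0r scaleNr.
Qed.

Let gap_cvg0 := scaled_gap_cvg0 dotE dfG subG z0_min a0 s0_gt0 lookahead_flow.
Let grad_cvg0 := scaled_gradient_cvg0 dotE dfG subG z0_min a0 s0_gt0 lookahead_flow.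

(** The gap [w = y - x = (s / a) v] solves [s w' = - a w - (s ^+ 2 / a) G y], so
    [|w|^2] satisfies the differential inequality with [b = a], half of the
    damping being spent on the forcing term by Young's inequality. *)
Lemma scaled_velocity_cvg0 : s *: v s @[s --> +oo] --> 0.
Proof.
pose w s := (s / a) *: v s.
have dw s : s0 < s -> is_derive s 1 w (- (s / a) *: G (y s) - v s).
  move=> hs; have := is_deriveB (lookahead_flow hs) (dx hs).
  rewrite (_ : y - x = w)//; apply/funext => t.
  by rewrite /w -[LHS]/(y t - x t) /lookahead addrC addKr.
have : `|w s| ^+ 2 @[s --> +oo] --> (0 : R).
  apply: (@differential_inequality_cvg0 _ _
     (fun s => 2 * dot (w s) (- (s / a) *: G (y s) - v s))
     (fun s => (s ^+ 2 * `|G (y s)|) ^+ 2 / a ^+ 3) a s0) => //.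
  - by move=> s hs; exact: (is_derive_sqr_norm dotE (dw s hs)).
  - move=> s hs; have s_gt0 := pos hs.
    have vw : v s = (a / s) *: w s.
      by rewrite scalerA mulrA divfK ?gt_eqF// divff ?scale1r// gt_eqF.
    rewrite vw dotBr 2!dotZr -dotE.
    have := cauchy_schwarz dotE (w s) (G (y s)); rewrite ler_norml => /andP[cs _].
    move: cs (normr_ge0 (w s)) (normr_ge0 (G (y s))).
    move: (dot _ _) (`|w s|) (`|G _|) => d p q cs p0 q0.
    have -> : s * (2 * (- (s / a) * d - a / s * p ^+ 2)) =
       - (2 * s ^+ 2 / a) * d - 2 * a * p ^+ 2.
      by field; rewrite !gt_eqF.
    have le1 : - (2 * s ^+ 2 / a) * d <= (2 * s ^+ 2 / a) * (p * q).
      rewrite mulNr -mulrN ler_wpM2l// 1?lerNl//.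
      by rewrite divr_ge0 ?mulr_ge0 ?exprn_ge0 ?(ltW s_gt0) ?(ltW a0).
    have le2 : (2 * s ^+ 2 / a) * (p * q) <=
      a * p ^+ 2 + (s ^+ 2 * q) ^+ 2 / a ^+ 3.
      rewrite -subr_ge0.
      have -> : a * p ^+ 2 + (s ^+ 2 * q) ^+ 2 / a ^+ 3 - 2 * s ^+ 2 / a * (p * q) =
        (a * p - s ^+ 2 * q / a) ^+ 2 / a.
        by field; rewrite gt_eqF.
      by rewrite divr_ge0 ?sqr_ge0 ?(ltW a0).
    by move: le1 le2; lra.
  - rewrite -[X in _ --> X](mul0r ((a ^+ 3)^-1)); apply: cvgM; last exact: cvg_cst.
    by have := cvgM grad_cvg0 grad_cvg0; rewrite mulr0; apply.
move=> /cvgr0_sqr/norm_cvg0P w0.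
have : a *: w s @[s --> +oo] --> a *: 0 by apply: cvgZ => //; exact: cvg_cst.
rewrite scaler0; apply: cvg_trans; apply: near_eq_cvg; near=> s.
by rewrite scalerA mulrC divfK ?gt_eqF.
Unshelve. all: by end_near. Qed.

(** Since [s v = a (y - x)], convexity of [f] between [x] and [y] gives
    [s (f x)' <= a (f y - f x)]; the weight [s ^+ 2] costs [2], leaving the rate
    [b = a - 2]. *)
Lemma scaled_value_cvg0 : 2 < a ->
  s ^+ 2 * (f (x s) - f z0) @[s --> +oo] --> (0 : R).
Proof.
move=> a2.
have dF s : s0 < s -> is_derive s 1 (fun t => t ^+ 2 * (f (x t) - f z0))
    (2 * s * (f (x s) - f z0) + s ^+ 2 * dot (G (x s)) (v s)).
  move=> hs.
  have d1 := is_deriveB (is_derive_gradient dfG (dx hs)) (is_derive_cst (f z0) s 1).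
  rewrite subr0 in d1.
  exact: (is_derive1M (is_derive1X 1 s) d1).
apply: (@differential_inequality_cvg0 _ _ _
   (fun s => a * (s ^+ 2 * (f (y s) - f z0))) (a - 2) s0 _ _ dF).
- by rewrite subr_gt0.
- by move=> s _; rewrite mulr_ge0 ?sqr_ge0// subr_ge0.
- move=> s hs; have s_gt0 := pos hs.
  have vw : v s = (a / s) *: (y s - x s).
    rewrite /lookahead addrC addKr scalerA mulrA divfK ?gt_eqF//.
    by rewrite divff ?scale1r// gt_eqF.
  rewrite vw dotZr; have := subG (x s) (y s).
  move: (dot _ _) (f (x s)) (f (y s)) (f z0) => d p q m h.
  have -> : s * (2 * s * (p - m) + s ^+ 2 * (a / s * d)) =
     s ^+ 2 * (2 * (p - m) + a * d) by field; rewrite gt_eqF.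
  have -> : - (a - 2) * (s ^+ 2 * (p - m)) + a * (s ^+ 2 * (q - m)) =
     s ^+ 2 * (2 * (p - m) + a * (q - p)) by ring.
  rewrite ler_wpM2l ?sqr_ge0// lerD2l ler_wpM2l ?(ltW a0)//.
  by move: h; lra.
- rewrite -[X in _ --> X](mulr0 a); apply: cvgM; first exact: cvg_cst.
  exact: gap_cvg0.
Qed.

Lemma trajectory_weak_cvg : exists2 l, argmin f l & weakly_cvg_to x +oo l.
Proof.
have ne : argmin f !=set0 by exists z0.
have [l lmin yl] := flow_weak_cvg dotE dfG subG ne a0 s0_gt0 lookahead_flow.
exists l => // phi cphi; have [c hc] := riesz dotE cphi.
have lim : dot (y s) c - a^-1 * dot (s *: v s) c @[s --> +oo] -->
    dot l c - a^-1 * dot 0 c.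
  apply: cvgB; first exact: yl.
  apply: cvgM; first exact: cvg_cst.
  apply: (cvg_dot dotE); [exact: scaled_velocity_cvg0|exact: cvg_cst].
have -> : phi l = dot l c - a^-1 * dot 0 c.
  by rewrite -(scale0r 0) dotZl mul0r mulr0 subr0 hc dotC.
apply: cvg_trans lim; apply: near_eq_cvg; near=> s.
rewrite hc [dot c _]dotC /lookahead dotDl !dotZl; move: (dot _ _) (dot _ _) => p q.
by field; rewrite gt_eqF.
Unshelve. all: by end_near. Qed.

End Dynamics.

(** * One-sided derivatives on a half-line *)

Section DerivableOn.
Context (R : realType) (H : normedModType R).

Lemma derivable_on_is_derive (s0 s : R) (x : R -> H) : s0 < s ->
  derivable_on `[s0, +oo[ x s -> is_derive s 1 x (derive_on `[s0, +oo[ x s).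
Proof.
move=> hs dx; have lim : (t - s)^-1 *: (x t - x s) @[t --> s^'] -->
    derive_on `[s0, +oo[ x s.
  apply: cvg_trans dx; apply: cvg_app => P.
  rewrite /within/= => hP; have sD : \forall t \near s^', s0 <= t.
    apply: nbhs_dnbhs; apply: filterS (lt_nbhsr hs) => r /ltW; exact.
  have hP' : \forall t \near s^', `[s0, +oo[%classic t -> P t by exact: hP.
  change (\forall t \near s^', P t); near=> t.
  by apply: (near hP' t) => //=; rewrite in_itv/= andbT; near: t.
apply/is_derive1P.
have -> : (fun h => h^-1 *: (x (h + s) - x s)) =
    (fun t => (t - s)^-1 *: (x t - x s)) \o shift s.
  by apply/funext => h /=; rewrite addrK.
apply: cvg_comp lim => P [e /= e0 he]; exists e => //= h.
rewrite /ball_/= sub0r normrN => he' h0; apply: he => /=.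
  by rewrite opprD addrCA subrr addr0 normrN.
by rewrite -subr_eq0 addrK.
Unshelve. all: by end_near. Qed.

Lemma derivable_on_right_cvg (s0 : R) (x : R -> H) :
  derivable_on `[s0, +oo[ x s0 -> x s @[s --> s0^'+] --> x s0.
Proof.
move=> dx.
have lim : (t - s0)^-1 *: (x t - x s0) @[t --> s0^'+] --> derive_on `[s0, +oo[ x s0.
  apply: cvg_trans dx; apply: cvg_app => P.
  rewrite /within/= => hP.
  have hP' : \forall t \near s0^', `[s0, +oo[%classic t -> P t by exact: hP.
  have hP2 : \forall t \near s0^'+, `[s0, +oo[%classic t -> P t.
    have [e /= e0 he] := hP'; exists e => //= t te st.
    by apply: he => //=; rewrite gt_eqF.
  change (\forall t \near s0^'+, P t); near=> t.
  apply: (near hP2 t) => //=; rewrite in_itv/= andbT; near: t.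
  exact: nbhs_right_ge.
have z : (t - s0) *: ((t - s0)^-1 *: (x t - x s0)) + x s0 @[t --> s0^'+] --> x s0.
  rewrite -[X in _ --> X]add0r; apply: cvgD; last exact: cvg_cst.
  rewrite -(scale0r (derive_on `[s0, +oo[ x s0)); apply: cvgZ lim.
  rewrite -[X in _ --> X](subrr s0); apply: cvgB; last exact: cvg_cst.
  exact: cvg_at_right_filter.
apply: cvg_trans z; apply: near_eq_cvg; near=> t.
by rewrite scalerA divff ?scale1r ?subrK// subr_eq0 gt_eqF.
Unshelve. all: by end_near. Qed.

Lemma derivable_on_within_continuous (s0 : R) (x : R -> H) :
  {in `[s0, +oo[%classic, forall s, derivable_on `[s0, +oo[ x s} ->
  {within `[s0, +oo[, continuous x}.
Proof.
move=> dx; apply/continuous_within_itvcyP; split.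
  move=> s; rewrite in_itv/= andbT => hs.
  apply/differentiable_continuous/derivable1_diffP.
  have h : derivable_on `[s0, +oo[ x s by apply: dx; rewrite inE/= in_itv/= ltW.
  exact: (@ex_derive _ _ _ _ _ _ _ (derivable_on_is_derive hs h)).
by apply: derivable_on_right_cvg; apply: dx; rewrite inE/= in_itv/= lexx.
Qed.

End DerivableOn.

Theorem theorem2 (R : realType) (H : completeNormedModType R)
    (dot : {dot H for (idfun : R -> R)}) (dotE : norm_from_dot dot)
    (f : H -> R)
    (f_convex : convex_function [set: convex_lmodType H] f)
    (f_C1 : class_C1 f)
    (f_argmin : argmin f !=set0)
    (f_lip : forall B : set H, bounded_set B ->
       [lipschitz (gradient dot f) y | y in B])
    (s0 : R) (s0_gt0 : 0 < s0) (alpha : R) (alpha_gt1 : 1 < alpha)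
    (x : R -> H) (x_sol : solution_trajectory dot f alpha s0 x) :
  [/\ (\int[@lebesgue_measure R]_(s in `[s0, +oo[)
         (s ^+ 3 * `|gradient dot f
           (x s + (s / (alpha - 1)) *: velocity s0 x s)| ^+ 2)%:E < +oo)%E,
      (fun s : R => `|gradient dot f
         (x s + (s / (alpha - 1)) *: velocity s0 x s)|)
        =o_+oo (fun s : R => 1 / s ^+ 2),
      (fun s : R => `|velocity s0 x s|) =o_+oo (fun s : R => 1 / s),
      (exists2 l : H, argmin f l & weakly_cvg_to x +oo l) &
      (3 < alpha ->
       (fun s : R => f (x s) - inf (range f))
         =o_+oo (fun s : R => 1 / s ^+ 2))].
Proof.
have gc := gradient_continuous dotE f_C1.
case: f_C1 => df _; case: x_sol => -[dx ddx _] ode.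
have [z0 z0_min] := f_argmin.
have dfG y : differentiable f y /\ forall v, 'd f y v = dot (gradient dot f y) v.
  by split=> //; exact: gradient_spec.
have subG := gradient_convex_le dotE f_convex df.
have cx := derivable_on_within_continuous dx.
have cv := derivable_on_within_continuous ddx.
have dx1 s : s0 < s -> is_derive s 1 x (velocity s0 x s).
  move=> hs; apply: derivable_on_is_derive => //; apply: dx.
  by rewrite inE/= in_itv/= ltW.
have dv1 s : s0 < s -> is_derive s 1 (velocity s0 x) (acceleration s0 x s).
  move=> hs; apply: derivable_on_is_derive => //; apply: ddx.
  by rewrite inE/= in_itv/= ltW.
pose a := alpha - 1.
have a0 : 0 < a by rewrite subr_gt0.
have ode' s : s0 <= s -> acceleration s0 x s + ((a + 1) / s) *: velocity s0 x s +
    gradient dot f (lookahead a x (velocity s0 x) s) = 0.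
  by rewrite subrK; exact: ode.
have cy : {within `[s0, +oo[, continuous (lookahead a x (velocity s0 x))}.
  move=> s; apply: cvgD; first exact: cx.
  apply: cvgZ; last exact: cv.
  apply: cvgM; last exact: cvg_cst.
  exact: (@continuous_subspaceT _ _ _ (fun s : R => s) (fun s => cvg_id) s).
move: (gradient dot f) (velocity s0 x) (acceleration s0 x) gc dfG subG dx1 dv1 ode' cy
  {cv f_convex f_lip dx ddx ode} => G v acc gc dfG subG dx1 dv1 ode' cy.
have flow := lookahead_flow a0 s0_gt0 dx1 dv1 ode'.
split.
- apply: (scaled_gradient_finite_integral dotE dfG subG z0_min a0 s0_gt0 flow cy).
  exact: within_continuous_comp (in1W gc) cy.
- apply: littleo_inv_pow.
  exact: (scaled_gradient_cvg0 dotE dfG subG z0_min a0 s0_gt0 flow).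
- apply: (@littleo_inv_pow _ 1); apply/norm_cvg0P.
  have := scaled_velocity_cvg0 dotE dfG subG z0_min a0 s0_gt0 dx1 dv1 ode'.
  move=> /cvg_norm; rewrite normr0; apply: cvg_trans; apply: near_eq_cvg; near=> s.
  by rewrite normrZ normrM normr_id.
- exact: (trajectory_weak_cvg dotE dfG subG z0_min a0 s0_gt0 dx1 dv1 ode').
- move=> alpha3; apply: littleo_inv_pow.
  have -> : inf (range f) = f z0.
    apply/eqP; rewrite eq_le; apply/andP; split.
      by apply: ge_inf; [exists (f z0) => _ [z _ <-]|exists z0].
    by apply: lb_le_inf; [exists (f z0), z0|move=> _ [z _ <-]].
  apply: (scaled_value_cvg0 dotE dfG subG z0_min a0 s0_gt0 dx1 dv1 ode').
  by rewrite ltrBrDr -natr1 in alpha3 *.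
Unshelve. all: by end_near. Qed.
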